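(* For every real matrix $A\in\mathbb{R}^{X\times Y}$ and every $\alpha>0$, $$\operatorname{Ldim}_\alpha(A)\le\frac{4\|A\|_{\gamma_2}^2}{\alpha^2}.$$
   Context: Factorization norm: for a real matrix $A:X\times Y\to\mathbb{R}$, $$\|A\|_{\gamma_2}:=\inf\Big\{\big(\sup_x\|u_x\|\big)\big(\sup_y\|v_y\|\big):A(x,y)=\langle u_x,v_y\rangle\text{ for some Hilbert space vectors }u_x,v_y\Big\}.$$ Weighted mistake tree: a weighted mistake tree of depth $d$ over $X$ is a complete binary tree of depth $d$ whose internal nodes $\nu$ are labelled by pairs $(x(\nu),w(\nu))\in X\times\mathbb{R}$. The matrix $A$ $\alpha$-shatters the tree if for every root-to-leaf path there is a column $y\in Y$ such that at each internal node $\nu$ on the path, $A(x(\nu),y)\ge w(\nu)+\alpha/2$ if the path turns left at $\nu$, and $A(x(\nu),y)\le w(\nu)-\alpha/2$ if the path turns right at $\nu$. The weighted Littlestone dimension $\operatorname{Ldim}_\alpha(A)$ is the largest depth of a weighted mistake tree that $A$ $\alpha$-shatters. *)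

(* Defs.v *)
From HB Require Import structures.
From mathcomp Require Import all_boot all_order all_algebra.
From mathcomp Require Import all_classical all_reals all_analysis.
Set Implicit Arguments.
Unset Strict Implicit.
Unset Printing Implicit Defensive.
Import Order.TTheory GRing.Theory Num.Theory.
Import numFieldNormedType.Exports.
Local Open Scope classical_set_scope.
Local Open Scope ring_scope.

Record hilbertType (R : realType) := HilbertType {
  hilbert_sort :> completeNormedModType R ;
  inner : {dot hilbert_sort for (@idfun R)} ;
  inner_norm : forall x : hilbert_sort, inner x x = `|x| ^+ 2 }.

(* The point 0 is added so that the supremum of an empty family of norms is 0
   (ereal_sup set0 is -oo); it changes nothing when I is nonempty. *)
Definition sup_norm (R : realType) (H : hilbertType R) (I : Type) (u : I -> H)
    : \bar R :=
  ereal_sup (0%E |` range (fun i => `|u i|%:E)).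

(* Equal to +oo when A has no factorization through bounded families, which
   can only happen if X or Y is infinite. In \bar R, 0 * +oo is 0. *)
Definition gamma2_norm (R : realType) (X Y : Type) (A : X -> Y -> R) : \bar R :=
  ereal_inf [set c | exists (H : hilbertType R) (u : X -> H) (v : Y -> H),
    (forall x y, A x y = inner H (u x) (v y)) /\
    c = (sup_norm u * sup_norm v)%E].

Inductive mistake_tree (R : realType) (X : Type) : nat -> Type :=
| MTLeaf : mistake_tree R X 0
| MTNode d : X -> R -> mistake_tree R X d -> mistake_tree R X d ->
    mistake_tree R X d.+1.

(* A root-to-leaf path is the sequence of its turns: true is left, false is
   right. *)
Fixpoint follows (R : realType) (X Y : Type) (A : X -> Y -> R) (alpha : R)
    (y : Y) (d : nat) (T : mistake_tree R X d) (p : seq bool) : Prop :=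
  match T, p with
  | MTNode _ x w l r, b :: p' =>
      if b then w + alpha / 2 <= A x y /\ follows A alpha y l p'
      else A x y <= w - alpha / 2 /\ follows A alpha y r p'
  | _, _ => True
  end.

Definition shatters (R : realType) (X Y : Type) (A : X -> Y -> R) (alpha : R)
    (d : nat) (T : mistake_tree R X d) : Prop :=
  forall p : d.-tuple bool, exists y : Y, follows A alpha y T p.

(* +oo when the depths of shattered trees are unbounded; -oo when no tree at
   all is shattered, i.e. when Y is empty. *)
Definition Ldim (R : realType) (X Y : Type) (alpha : R) (A : X -> Y -> R)
    : \bar R :=
  ereal_sup [set d%:R%:E | d in
    [set d : nat | exists T : mistake_tree R X d, shatters A alpha T]].

(* Main.v *)
(* Run online gradient descent in the Hilbert space, keeping a vector z and
   starting from z = 0.  At a node labelled (x, w) follow the branch on which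
   <u_x, z> is at distance at least alpha / 2 from the entry A(x, y) of every
   column y consistent with that branch, and move z by eta u_x towards it.  Each
   step lowers |z - v_y|^2 by at least eta alpha - eta^2 U^2, for the final
   column y, where U bounds the |u_x|.  Initially this quantity is |v_y|^2 and it
   stays nonnegative; the choice eta = alpha / (2 U^2) bounds the depth. *)
Require Import Defs.
From mathcomp Require Import all_boot all_order all_algebra.
From mathcomp Require Import all_classical all_reals all_analysis.
From mathcomp Require Import ring lra.
Set Implicit Arguments.
Unset Strict Implicit.
Unset Printing Implicit Defensive.
Import Order.TTheory GRing.Theory Num.Theory.
Local Open Scope ring_scope.

Lemma hilbert_normD (R : realType) (H : hilbertType R) (a b : H) :
  `|a + b| ^+ 2 = `|a| ^+ 2 + 2 * inner H a b + `|b| ^+ 2.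
Proof.
rewrite -!inner_norm linearDl !linearDr /=.
by rewrite [inner H b a]hermC /= expr0 mul1r; ring.
Qed.

(** Expanding the square around [z - v], the cross term is at most [- alpha * e] and the quadratic
    one at most [e ^+ 2 * U ^+ 2]. The sign of [c] stays free to serve both turns. *)
Lemma gradient_step (R : realType) (H : hilbertType R) (z v u : H)
    (alpha U e c : R) :
  c ^+ 2 = e ^+ 2 -> `|u| <= U -> alpha * e <= - 2 * c * inner H u (z - v) ->
  `|z + c *: u - v| ^+ 2 <= `|z - v| ^+ 2 - (e * alpha - e ^+ 2 * U ^+ 2).
Proof.
move=> ce uU step; rewrite addrAC (hilbert_normD (z - v)).
rewrite [inner H _ (c *: u)]hermC /= expr0 mul1r linearZl_LR /=.
rewrite normrZ exprMn real_normK ?num_real// ce.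
have : e ^+ 2 * `|u| ^+ 2 <= e ^+ 2 * U ^+ 2.
  by rewrite ler_wpM2l ?sqr_ge0// lerXn2r ?nnegrE// (le_trans _ uU).
by move: step; lra.
Qed.

(** Each turn depends only on [z], never on [y], so one path serves every column; the induction is
    over all [z] because each step moves it. *)
Lemma descent_path (R : realType) (X Y : Type) (A : X -> Y -> R) (alpha : R)
    (H : hilbertType R) (u : X -> H) (v : Y -> H) (U e : R) :
  (forall x y, A x y = inner H (u x) (v y)) ->
  (forall x, `|u x| <= U) -> 0 <= e ->
  forall (d : nat) (T : mistake_tree R X d) (z : H),
  exists p : d.-tuple bool, forall y, follows A alpha y T p ->
    d%:R * (e * alpha - e ^+ 2 * U ^+ 2) <= `|z - v y| ^+ 2.
Proof.
move=> AE uU e0 d; elim=> [z|{}d x w l IHl r IHr z].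
  by exists [tuple] => y _; rewrite mul0r sqr_ge0.
have [le_w|lt_w] := lerP w (inner H (u x) z).
- have [p Hp] := IHr (z + (- e) *: u x).
  exists [tuple of false :: p] => y /= [Ay /Hp].
  have := @gradient_step R H z (v y) (u x) alpha U e (- e).
  rewrite sqrrN linearBr /= -AE => /(_ erefl (uU x)).
  (* On the right branch [A x y <= w - alpha / 2], while [w <= inner H (u x) z]. *)
  have : alpha * e <= -2 * - e * (inner H (u x) z - A x y) by nra.
  by move=> /[swap] /[apply]; rewrite -natr1; lra.
- have [p Hp] := IHl (z + e *: u x).
  exists [tuple of true :: p] => y /= [Ay /Hp].
  have := @gradient_step R H z (v y) (u x) alpha U e e.
  rewrite linearBr /= -AE => /(_ erefl (uU x)).
  have : alpha * e <= -2 * e * (inner H (u x) z - A x y) by nra.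
  by move=> /[swap] /[apply]; rewrite -natr1; lra.
Qed.

Lemma shattered_depth (R : realType) (X Y : Type) (A : X -> Y -> R) (alpha : R)
    (H : hilbertType R) (u : X -> H) (v : Y -> H) (U V : R) (d : nat)
    (T : mistake_tree R X d) :
  (forall x y, A x y = inner H (u x) (v y)) ->
  0 <= alpha -> 0 < U -> (forall x, `|u x| <= U) -> (forall y, `|v y| <= V) ->
  shatters A alpha T -> d%:R * alpha ^+ 2 <= 4 * (U * V) ^+ 2.
Proof.
move=> AE alpha0 U0 uU vV shT.
(* This maximizes the gain per step, [e * alpha - e ^+ 2 * U ^+ 2], at
   [alpha ^+ 2 / (4 * U ^+ 2)]. *)
pose e := alpha / (2 * U ^+ 2).
have e0 : 0 <= e by rewrite divr_ge0// mulr_ge0// sqr_ge0.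
have [p Hp] := descent_path alpha AE uU e0 T 0.
have [y /Hp] := shT p; rewrite sub0r normrN => le_v.
have -> : d%:R * alpha ^+ 2 =
    4 * (U ^+ 2 * (d%:R * (e * alpha - e ^+ 2 * U ^+ 2))).
  by rewrite /e; field; rewrite gt_eqF.
rewrite (exprMn 2 U) ler_wpM2l// ler_wpM2l ?sqr_ge0//; apply: (le_trans le_v).
by rewrite lerXn2r ?nnegrE// (le_trans _ (vV y)).
Qed.

Lemma sup_norm_ge0 (R : realType) (H : hilbertType R) (I : Type) (u : I -> H) :
  (0 <= sup_norm u)%E.
Proof. by apply: ereal_sup_ubound; left. Qed.

Lemma norm_le_sup_norm (R : realType) (H : hilbertType R) (I : Type)
    (u : I -> H) (i : I) :
  (`|u i|%:E <= sup_norm u)%E.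
Proof. by apply: ereal_sup_ubound; right; exists i. Qed.

Lemma sup_norm_eq0 (R : realType) (H : hilbertType R) (I : Type) (u : I -> H) :
  sup_norm u = 0%E -> forall i, u i = 0.
Proof.
move=> u0 i; apply/eqP; have := norm_le_sup_norm u i.
by rewrite u0 lee_fin normr_le0.
Qed.

(** Taking square roots makes the bound linear in the cost of a factorization, so it passes to the
    infimum. *)
Lemma sqrt_depth_le_gamma2 (R : realType) (X Y : Type) (A : X -> Y -> R)
    (alpha : R) (d : nat) (T : mistake_tree R X d) :
  0 <= alpha -> shatters A alpha T ->
  ((Num.sqrt d%:R * alpha / 2)%:E <= gamma2_norm A)%E.
Proof.
move=> alpha0 shT; apply: le_ereal_inf_tmp => _ [H [u [v [AE ->]]]].
have sqrt_le (u' : X -> H) (v' : Y -> H) (U V : R) :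
    (forall x y, A x y = inner H (u' x) (v' y)) -> 0 < U -> 0 <= V ->
    (forall x, `|u' x| <= U) -> (forall y, `|v' y| <= V) ->
    Num.sqrt d%:R * alpha / 2 <= U * V.
  move=> AE' U0 V0 uU vV.
  rewrite -(@ler_pXn2r _ 2) ?nnegrE ?divr_ge0 ?mulr_ge0 ?sqrtr_ge0 ?(ltW U0)//.
  rewrite !exprMn sqr_sqrtr// -exprMn.
  by have := shattered_depth AE' alpha0 U0 uU vV shT; lra.
(* Since 0 * +oo = 0, a factorization with u = 0 may have unbounded v; then
   A = 0, and zero vectors factor it within the bounds. *)
have [A0|] := pselect (forall x y, A x y = 0).
  rewrite (le_trans _ (mule_ge0 (sup_norm_ge0 u) (sup_norm_ge0 v)))// lee_fin.
  (* [sqrt_le] needs a positive [U], hence the bounds 1 and 0. *)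
  rewrite -(mulr0 1); apply: (sqrt_le (fun=> 0) (fun=> 0)) => //.
  - by move=> x y; rewrite A0 linear0l.
  - by move=> x; rewrite normr0.
  - by move=> y; rewrite normr0.
move=> A_neq0.
(* With both suprema positive, an infinite one makes the product [+oo]. *)
have su_gt0 : (0 < sup_norm u)%E.
  rewrite lt0e sup_norm_ge0 andbT; apply/eqP => /sup_norm_eq0 u0.
  by apply: A_neq0 => x y; rewrite AE u0 linear0l.
have sv_gt0 : (0 < sup_norm v)%E.
  rewrite lt0e sup_norm_ge0 andbT; apply/eqP => /sup_norm_eq0 v0.
  by apply: A_neq0 => x y; rewrite AE v0 linear0r.
have := norm_le_sup_norm u; have := norm_le_sup_norm v.
move: su_gt0 sv_gt0; case: (sup_norm u) => [U||]//; last first.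
  by move=> _ V0 _ _; rewrite gt0_mulye// leey.
case: (sup_norm v) => [V||]//; last by move=> U0 _ _ _; rewrite gt0_muley// leey.
rewrite !lte_fin -EFinM lee_fin => U0 V0 vV uU.
by apply: (sqrt_le u v) => //; exact: ltW.
Qed.

Theorem theorem4p1 (R : realType) (X Y : Type) (A : X -> Y -> R) (alpha : R)
    (alpha_gt0 : 0 < alpha) :
  (Ldim alpha A <= 4%:R%:E * gamma2_norm A ^+ 2 / (alpha ^+ 2)%:E)%E.
Proof.
apply: ge_ereal_sup => _ [d [T shT] <-].
have le_g := sqrt_depth_le_gamma2 (ltW alpha_gt0) shT.
have s0 : 0 <= Num.sqrt d%:R * alpha / 2.
  by rewrite divr_ge0// mulr_ge0 ?sqrtr_ge0// ltW.
rewrite inver gt_eqF ?exprn_gt0// lee_pdivlMr ?exprn_gt0// -EFinM.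
(* This form lets [le_g] be squared, both of its sides being nonnegative. *)
have -> : d%:R * alpha ^+ 2 = 4 * (Num.sqrt d%:R * alpha / 2) ^+ 2.
  by rewrite !exprMn sqr_sqrtr//; field.
rewrite EFinM lee_pmul2l// EFin_expe lee_sqr// ?lee_fin//.
by rewrite (le_trans _ le_g) ?lee_fin.
Qed.
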